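(* Let $\rho$ be an odd prime with $\rho\equiv\pm5\pmod{12}$ and $\mathrm{ord}_\rho(3)=\rho-1$, let $m=\rho-1$, let $\alpha$ be a primitive element of $\mathrm{GF}(3^m)$, $\beta=\alpha^{(3^m-1)/(4\rho)}$, $\theta=\beta^{-1}$. Let $\mathcal{C}(\rho)=\{(\mathrm{Tr}_{3^m/3}(a\theta^i))_{i=0}^{2\rho-1}: a\in\mathrm{GF}(3^m)\}$, the ternary negacyclic code of length $2\rho$ with check polynomial the minimal polynomial of $\beta$ over $\mathrm{GF}(3)$. Let $h$ be any odd integer in $\{0,\dots,4\rho-1\}$ not in $\{3^j\bmod 4\rho:j\ge0\}\cup\{\rho,3\rho\}$, and let $$\overline{\mathcal{C}}(\rho)^\perp=\left\{\left(a(-1)^i+\mathrm{Tr}_{3^m/3^2}(b\beta^{2hi})\right)_{i=0}^{\rho-1}: a\in\mathrm{GF}(3^2),\ b\in\mathrm{GF}(3^m)\right\},$$ the dual of the $\mathrm{GF}(9)$-linear code $\{(\mathrm{Tr}_{3^m/3^2}(a\theta^{2i}))_{i=0}^{\rho-1}:a\in\mathrm{GF}(3^m)\}$. Then the dual code $\mathcal{C}(\rho)^\perp$ has parameters $[2\rho,\rho+1,d^\perp]$, where $d^\perp\ge d(\overline{\mathcal{C}}(\rho)^\perp)\ge\sqrt{\rho}$.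
   Context: A ternary negacyclic code of length $n$ is an ideal of $\mathrm{GF}(3)[x]/(x^n+1)$; its check polynomial is $(x^n+1)/g(x)$ with $g$ the monic generator polynomial. $\mathrm{Tr}_{3^m/3^k}$ denotes the trace from $\mathrm{GF}(3^m)$ to $\mathrm{GF}(3^k)$. $\perp$ denotes the Euclidean dual, $d(\cdot)$ the minimum Hamming distance, $[n,k,d]$ length, dimension, minimum distance. *)

(* Defs.v *)
From HB Require Import structures.
From mathcomp Require Import all_boot all_order all_algebra all_field.
Set Implicit Arguments. Unset Strict Implicit. Unset Printing Implicit Defensive.
Import GRing.Theory.
Local Open Scope ring_scope.

Definition is_mult_order (p a k : nat) : Prop :=
  (0 < k)%N /\ a ^ k = 1 %[mod p] /\
  (forall j : nat, (0 < j < k)%N -> a ^ j <> 1 %[mod p]).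

Section Codes.
Variable F : finFieldType.

Definition in_subfield (q : nat) (x : F) : bool := x ^+ q == x.

(* Trace from F (of order 3^m) to GF(3^k), where m = k * r :
   Tr(x) = sum_{j < r} x^(3^(k j)) *)
Definition trace_to (k r : nat) (x : F) : F :=
  \sum_(j < r) x ^+ (3 ^ (k * j))%N.

Definition wt (n : nat) (c : 'rV[F]_n) : nat := #|[set i : 'I_n | c 0 i != 0]|.

(* Minimum distance = minimum weight of a nonzero codeword
   (conventionally n.+1 if there is none). *)
Definition mindist (n : nat) (C : {set 'rV[F]_n}) : nat :=
  \big[minn/n.+1]_(c in C | c != 0) wt c.

Definition dual_over (q n : nat) (C : {set 'rV[F]_n}) : {set 'rV[F]_n} :=
  [set y : 'rV[F]_n | [forall i, in_subfield q (y 0 i)] &&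
     [forall c in C, \sum_(i < n) y 0 i * c 0 i == 0]].

End Codes.

(* Main.v *)
Require Import Defs.
From HB Require Import structures.
From mathcomp Require Import all_boot all_order all_algebra all_field.
From mathcomp Require Import ring zify.
Set Implicit Arguments. Unset Strict Implicit. Unset Printing Implicit Defensive.
Import GRing.Theory.
Local Open Scope ring_scope.

(** Dual words are the ternary vectors vanishing at [theta]; the first [m]
    powers of [theta] are independent over GF(3), which gives the dimension.

    Folding the halves of such a word with the fourth root of unity [theta ^ p]
    gives a GF(9)-word on [Z/p] with a zero at a [p]-th root of unity [xi], hence
    at every [xi ^ s] with [s] a square.  By Fourier inversion a dilation of it
    is [a + Tr (b z ^ x)] for any prescribed primitive [p]-th root of unity [z].

    For the square root bound, convolution with the quadratic character [chi]
    (the Paley matrix) sends [f = a + Tr (b z ^ x)] to [lam * f - lam * a], where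
    [lam] is a Gauss sum up to sign; [lam] is nonzero because 3 is a primitive
    root modulo [p].  If [a <> 0], convolving [f] with its dilation by a
    non-square gives a nonzero constant, so [p <= wt f ^ 2].  If [a = 0], the
    substitution [x |-> -1/x] twisted by [chi] turns a translate of [f] into a
    word of smaller weight with nonzero constant term. *)

(** * Convolution with an abstract quadratic character on a finite field *)

Section PaleyOperator.
Variables (E : finFieldType) (K : fieldType) (chi : E -> K) (u : E).
Hypothesis chi0 : chi 0 = 0.
Hypothesis chiM : forall x y, chi (x * y) = chi x * chi y.
Hypothesis chi_sqr : forall x : E, x != 0 -> chi x * chi x = 1.
Hypothesis chi_u : chi u = -1.
Hypothesis two_neq0 : 2%:R != 0 :> K.

Definition paley (f : E -> K) (x : E) : K := \sum_y chi (x - y) * f y.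

Definition convolve (f g : E -> K) (x : E) : K := \sum_y f y * g (x - y).

Definition supp (f : E -> K) : {set E} := [set x | f x != 0].

Lemma chi_u_neq0 : u != 0.
Proof.
apply/eqP=> u0; move: chi_u; rewrite u0 chi0 => /esym/eqP.
by rewrite oppr_eq0 oner_eq0.
Qed.

Lemma chi_neq0 (x : E) : x != 0 -> chi x != 0.
Proof.
move=> x0; apply/eqP=> c0; have := chi_sqr x0.
by rewrite c0 mulr0 => /esym/eqP; rewrite oner_eq0.
Qed.

(** Scaling the variable by [u] negates the sum, and 2 is invertible in [K]. *)
Lemma sum_chi : \sum_x chi x = 0.
Proof.
set S := \sum_x _; suff: S * 2%:R = 0.
  by move/eqP; rewrite mulf_eq0 (negPf two_neq0) orbF => /eqP.
have -> : S * 2%:R = S - chi u * S by rewrite chi_u; ring.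
rewrite {1}/S (reindex_inj (mulfI chi_u_neq0)) /= mulr_sumr -sumrB big1 //.
by move=> x _; rewrite chiM subrr.
Qed.

Lemma sum_paley f : \sum_x paley f x = 0.
Proof.
rewrite exchange_big big1 //= => y _; rewrite -mulr_suml.
by rewrite (reindex_inj (addIr y)) /= (eq_bigr chi) ?sum_chi ?mul0r // => x _;
  rewrite addrK.
Qed.

Lemma sum_of_paley_eigen f lam kap :
  (forall x, paley f x = lam * f x - kap) ->
  lam * (\sum_x f x) = kap * #|E|%:R.
Proof.
move=> Hf; have := sum_paley f.
rewrite (eq_bigr (fun x => lam * f x - kap)) // sumrB -mulr_sumr.
by rewrite sumr_const mulr_natr => /eqP; rewrite subr_eq0 => /eqP.
Qed.

Lemma convolveC f g x : convolve f g x = convolve g f x.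
Proof.
rewrite /convolve (reindex_inj (inv_inj (subKr x))) /=.
by apply: eq_bigr => y _; rewrite subKr mulrC.
Qed.

(** Associativity of convolution, [paley] being convolution with [chi]. *)
Lemma paley_convolve f g x :
  paley (convolve f g) x = convolve (paley f) g x.
Proof.
rewrite /paley /convolve.
transitivity (\sum_y \sum_z chi (x - y) * (f z * g (y - z))).
  by apply: eq_bigr => y _; rewrite mulr_sumr.
transitivity (\sum_y \sum_z chi (y - z) * f z * g (x - y)); last first.
  by apply: eq_bigr => y _; rewrite mulr_suml.
rewrite exchange_big [RHS]exchange_big /=; apply: eq_bigr => z _.
have inj : injective (fun y => x + z - y) by move=> a b /addrI /oppr_inj.
rewrite (reindex_inj inj) /=; apply: eq_bigr => y _.
rewrite mulrA; congr (chi _ * _ * g _); ring.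
Qed.

Lemma paley_convolve_eigen f g lam kap x :
  (forall x, paley f x = lam * f x - kap) ->
  paley (convolve f g) x = lam * convolve f g x - kap * \sum_y g y.
Proof.
move=> Hf; rewrite paley_convolve /convolve.
rewrite (eq_bigr (fun y => lam * (f y * g (x - y)) - kap * g (x - y))).
  rewrite sumrB -!mulr_sumr; congr (_ - _ * _).
  by rewrite (reindex_inj (inv_inj (subKr x))) /=; apply: eq_bigr => y _;
    rewrite subKr.
by move=> y _; rewrite Hf mulrBl mulrA.
Qed.

(** A nonzero value at [x] needs a nonzero summand, which writes [x] as a support point of [f] plus
    one of [g]; addition thus maps the product of the supports onto [E]. *)
Lemma convolve_supp f g :
  (forall x, convolve f g x != 0) -> (#|E| <= #|supp f| * #|supp g|)%N.
Proof.
move=> nz; rewrite -cardsX -cardsT.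
apply: leq_trans (leq_imset_card (fun yz : E * E => yz.1 + yz.2) _).
apply: subset_leq_card; apply/subsetP => x _.
have [/existsP [y /andP[fy gy]]|] := boolP [exists y, (f y != 0) && (g (x - y) != 0)].
  by apply/imsetP; exists (y, x - y); rewrite ?inE /= ?fy ?gy // subrKC.
move/existsPn=> H; have := nz x; rewrite /convolve big1 ?eqxx // => y _.
by have := H y; rewrite negb_and !negbK => /orP[] /eqP->; rewrite ?mul0r ?mulr0.
Qed.

(* Dilating [f] by a non-square negates its eigenvalue, so the convolution of
   the two words is killed by [2 * lam] up to a constant. *)
Lemma paley_eigen_odd_like f lam kap :
  #|E|%:R != 0 :> K -> lam != 0 -> kap != 0 ->
  (forall x, paley f x = lam * f x - kap) ->
  (#|E| <= #|supp f| ^ 2)%N.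
Proof.
move=> E0 lam0 kap0 Hf; pose g x := f (u * x).
have u0 := chi_u_neq0.
have Hg x : paley g x = - lam * g x - - kap.
  transitivity (chi u * paley f (u * x)); last by rewrite Hf chi_u /g; ring.
  rewrite /paley [in RHS](reindex_inj (mulfI u0)) /= mulr_sumr.
  apply: eq_bigr => y _; rewrite -mulrBr chiM chi_u /g.
  by rewrite !mulrA mulrNN !mul1r.
have sumg : \sum_x g x = \sum_x f x by rewrite [RHS](reindex_inj (mulfI u0)).
have sumf := sum_of_paley_eigen Hf.
have sf0 : \sum_x f x != 0.
  apply/eqP=> sf; move: sumf; rewrite sf mulr0 => /esym/eqP.
  by rewrite mulf_eq0 (negPf kap0) (negPf E0).
have -> : (#|supp f| ^ 2 = #|supp f| * #|supp g|)%N.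
  rewrite expnS expn1; congr (_ * _)%N.
  rewrite -(card_imset (supp g) (mulfI u0)); apply: eq_card => x.
  apply/idP/imsetP => [|[y]]; last by rewrite !inE /g => fy ->.
  rewrite inE => fx; exists (u^-1 * x); rewrite ?inE /g ?mulVKf //.
apply: convolve_supp => x; apply/eqP=> c0.
(* Where the convolution vanishes, [A] yields [- kap] times the sum of [g] and [B] yields [kap]
   times the sum of [f]. The two sums agree and convolution commutes, so [2 * kap] times a nonzero
   sum would be 0. *)
have A := paley_convolve_eigen g x Hf.
have B := paley_convolve_eigen f x Hg.
have C : paley (convolve f g) x = paley (convolve g f) x.
  by apply: eq_bigr => y _; rewrite convolveC.
move: A; rewrite C B convolveC c0 !mulr0 !sub0r sumg mulNr opprK => /eqP.
by rewrite -subr_eq0 opprK -mulr2n -mulr_natr !mulf_eq0 (negPf two_neq0)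
  (negPf kap0) (negPf sf0).
Qed.

(* The Gleason-Prange substitution [x |-> -1/x] on the projective line; the
   value [f 0] moves to infinity, where it becomes the inhomogeneous term. *)
Lemma paley_inversion f lam (f' := fun x => chi x * f (- x^-1)) :
  (forall x, paley f x = lam * f x) -> \sum_x f x = 0 ->
  forall x, paley f' x = lam * f' x - chi (-1) * f 0.
Proof.
move=> Hf sf x.
(* As [0^-1 = 0], this map is an involution of all of [E] fixing 0, so it can reindex full sums. *)
have injN : injective (fun y : E => - y^-1) by move=> a b /oppr_inj /invr_inj.
have NVK (y : E) : - (- y^-1)^-1 = y by rewrite invrN opprK invrK.
have [->|x0] := eqVneq x 0.
  (* At 0 the claim amounts to [f] summing to [- f 0] over the nonzero points. *)
  rewrite /f' chi0 mul0r mulr0 sub0r /paley.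
  rewrite (bigD1 0) //= chi0 mul0r mulr0 add0r.
  rewrite (eq_bigr (fun y => chi (-1) * f (- y^-1))); last first.
    by move=> y y0; rewrite mulrA -chiM sub0r mulNr -mulN1r chiM chiM chi_sqr ?mulr1.
  rewrite -mulr_sumr -mulrN; congr (_ * _).
  move: sf; rewrite (reindex_inj injN) /= (bigD1 0) //= invr0 oppr0 addrC.
  by move/eqP; rewrite addr_eq0 => /eqP.
rewrite /f' mulrCA -Hf /paley (reindex_inj injN) /=.
(* On the left the term at 0 dies with [chi 0]; on the right it equals [chi (-1) * f 0] and cancels
   the inhomogeneous term. *)
rewrite [in RHS](bigD1 0) //= (bigD1 0) //=.
rewrite invr0 oppr0 chi0 mul0r mulr0 add0r addr0 mulrDr mulrA -chiM.
rewrite mulrN divff // addrAC subrr add0r mulr_sumr.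
apply: eq_bigr => y y0; rewrite NVK mulrA mulrA -!chiM; congr (_ * _).
(* The two arguments differ by the square of [y^-1], on which [chi] is 1. *)
have -> : (x - - y^-1) * - y^-1 = (x * (- x^-1 - y)) * (y^-1 * y^-1).
  by field; rewrite x0 y0.
by rewrite chiM [chi (y^-1 * _)]chiM chi_sqr ?invr_eq0 ?mulr1.
Qed.

Lemma paley_eigen_supp f lam kap :
  #|E|%:R != 0 :> K -> lam != 0 ->
  (forall x, paley f x = lam * f x - kap) -> (exists x, f x != 0) ->
  (#|E| <= #|supp f| ^ 2)%N.
Proof.
move=> E0 lam0 Hf [x0 fx0].
have [k0|k0] := eqVneq kap 0; last exact: (paley_eigen_odd_like E0 lam0 k0 Hf).
(* Moving a support point to 0 makes [f1 0] nonzero, and with it the constant that the inversion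
   produces. *)
pose f1 x := f (x + x0); pose f2 x := chi x * f1 (- x^-1).
have Hf1 x : paley f1 x = lam * f1 x.
  transitivity (paley f (x + x0)); last by rewrite Hf k0 subr0.
  rewrite /paley [RHS](reindex_inj (addIr x0)) /=; apply: eq_bigr => y _.
  by rewrite /f1; congr (chi _ * _); ring.
have sf1 : \sum_x f1 x = 0.
  have := @sum_of_paley_eigen f1 lam 0; rewrite mul0r => H; apply/eqP.
  have /eqP : lam * (\sum_x f1 x) = 0 by apply: H => x; rewrite Hf1 subr0.
  by rewrite mulf_eq0 (negPf lam0).
have Hf2 := paley_inversion Hf1 sf1.
have N10 : -1 != 0 :> E by rewrite oppr_eq0 oner_eq0.
have kap2 : chi (-1) * f1 0 != 0 by rewrite mulf_neq0 ?chi_neq0 // /f1 add0r.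
apply: leq_trans (paley_eigen_odd_like E0 lam0 kap2 Hf2) _.
rewrite leq_sqr.
have inj : injective (fun y : E => - y^-1 + x0).
  by move=> a b /addIr /oppr_inj /invr_inj.
rewrite -(card_imset (supp f2) inj); apply: subset_leq_card.
apply/subsetP => _ /imsetP[y + ->]; rewrite !inE /f2 /f1.
by rewrite mulf_eq0 negb_or => /andP[].
Qed.

End PaleyOperator.

(** * Characteristic 3: polynomials over GF(3), evaluation kernels and duals of trace codes *)

Section CharThree.
Variable F : finFieldType.
Hypothesis char3 : 3 \in [pchar F].

Lemma exp3D j (x y : F) : (x + y) ^+ (3 ^ j) = x ^+ (3 ^ j) + y ^+ (3 ^ j).
Proof. by apply: exprDn_pchar; rewrite pnatX pnatE ?char3. Qed.

Lemma exp3_sum j (I : Type) (r : seq I) (P : pred I) (G : I -> F) :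
  (\sum_(i <- r | P i) G i) ^+ (3 ^ j) = \sum_(i <- r | P i) G i ^+ (3 ^ j).
Proof.
apply: (big_morph (fun x : F => x ^+ (3 ^ j)) (exp3D j)).
by rewrite expr0n expn_eq0.
Qed.

Lemma in_subfield_exp q j (x : F) : in_subfield q x -> x ^+ (q ^ j) = x.
Proof.
move/eqP=> xq; elim: j => [|j IH]; first by rewrite expr1.
by rewrite expnSr exprM IH.
Qed.

Lemma in_subfield9W (x : F) : in_subfield 3 x -> in_subfield 9 x.
Proof. by move/(in_subfield_exp 2)/eqP. Qed.

Lemma in_subfieldM q (x y : F) :
  in_subfield q x -> in_subfield q y -> in_subfield q (x * y).
Proof. by rewrite /in_subfield exprMn => /eqP-> /eqP->. Qed.

Lemma in_subfieldD j (x y : F) :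
  in_subfield (3 ^ j) x -> in_subfield (3 ^ j) y -> in_subfield (3 ^ j) (x + y).
Proof. by rewrite /in_subfield exp3D => /eqP-> /eqP->. Qed.

Lemma in_subfield_sum j (I : Type) (r : seq I) (P : pred I) (G : I -> F) :
  (forall i, P i -> in_subfield (3 ^ j) (G i)) ->
  in_subfield (3 ^ j) (\sum_(i <- r | P i) G i).
Proof.
move=> H; rewrite /in_subfield exp3_sum; apply/eqP.
by apply: eq_bigr => i Pi; apply/eqP/H.
Qed.

Lemma two_neq0_char3 : 2%:R != 0 :> F.
Proof. by rewrite -(dvdn_pcharf char3). Qed.

Lemma in_subfield3P (x : F) :
  reflect (x \in [:: 0; 1; -1]) (in_subfield 3 x).
Proof.
apply: (iffP idP); last first.
  by rewrite !inE /in_subfield => /or3P[] /eqP->; rewrite ?expr0n ?expr1n //;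
    rewrite !exprS expr0 mulr1 !mulN1r !opprK.
rewrite /in_subfield -subr_eq0 !inE.
have -> : x ^+ 3 - x = x * ((x - 1) * (x + 1)) by ring.
by rewrite !mulf_eq0 subr_eq0 addr_eq0.
Qed.

Lemma card_subfield3 : #|[pred x : F | in_subfield 3 x]| = 3%N.
Proof.
have un : uniq [:: 0; 1; -1 : F].
  rewrite /= !inE negb_or eq_sym oner_eq0 eq_sym oppr_eq0 oner_eq0 /= andbT.
  by rewrite -subr_eq0 opprK -mulr2n two_neq0_char3.
rewrite -[RHS](card_uniqP un); apply: eq_card => x.
by apply/in_subfield3P/idP.
Qed.

Lemma poly3_horner_exp (P : {poly F}) (x : F) j :
  (forall i, in_subfield 3 P`_i) -> P.[x] ^+ (3 ^ j) = P.[x ^+ (3 ^ j)].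
Proof.
move=> H; rewrite !horner_coef exp3_sum; apply: eq_bigr => i _.
by rewrite exprMn (in_subfield_exp j (H i)) -!exprM mulnC.
Qed.

(** Frobenius fixes the coefficients, so every [x ^+ (3 ^ j)] is a root as well; [m] distinct roots
    are too many for a nonzero polynomial of degree below [m]. *)
Lemma poly3_root_eq0 m (P : {poly F}) (x : F) :
  (forall i, in_subfield 3 P`_i) -> (size P <= m)%N ->
  {in gtn m &, injective (fun j => x ^+ (3 ^ j))} ->
  root P x -> P = 0.
Proof.
move=> HP sP injx /rootP Px; apply/eqP; apply: contraT => P0.
have rP : all (root P) [seq x ^+ (3 ^ j) | j <- iota 0 m].
  apply/allP => _ /mapP[j _ ->]; apply/rootP.
  by rewrite -poly3_horner_exp // Px expr0n expn_eq0.
have un : uniq [seq x ^+ (3 ^ j) | j <- iota 0 m]; last first.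
  by have := max_poly_roots P0 rP un; rewrite size_map size_iota ltnNge sP.
rewrite map_inj_in_uniq ?iota_uniq // => i j.
rewrite !mem_iota !add0n /= => im jm; exact: injx.
Qed.

Definition rows3 n : {set 'rV[F]_n} :=
  [set y : 'rV[F]_n | [forall i, in_subfield 3 (y 0 i)]].

Definition row_eval (x : F) n (y : 'rV[F]_n) : F := \sum_(i < n) y 0 i * x ^+ i.

Lemma card_rows3 n : #|rows3 n| = (3 ^ n)%N.
Proof.
transitivity #|ffun_on [pred x : F | in_subfield 3 x] : pred {ffun 'I_n -> F}|;
  last first.
  by rewrite card_ffun_on card_subfield3 card_ord.
pose r (f : {ffun 'I_n -> F}) : 'rV_n := \row_i f i.
have rinj : injective r.
  by move=> f g /rowP E; apply/ffunP => i; have := E i; rewrite !mxE.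
rewrite -(card_imset _ rinj); apply: eq_card => y; apply/idP/imsetP.
  rewrite inE => /forallP H; exists [ffun i => y 0 i].
    by apply/ffun_onP => i; rewrite ffunE inE.
  by apply/rowP => i; rewrite !mxE ffunE.
move=> [f /ffun_onP H ->]; rewrite inE; apply/forallP => i.
by rewrite mxE; exact: H.
Qed.

Lemma row_eval_inj m (x : F) :
  {in gtn m &, injective (fun j => x ^+ (3 ^ j))} ->
  {in rows3 m &, injective (@row_eval x m)}.
Proof.
move=> injx y z; rewrite !inE => /forallP Hy /forallP Hz /eqP.
rewrite -subr_eq0 /row_eval -sumrB => /eqP E.
pose d i := if insub i is Some k then y 0 (k : 'I_m) - z 0 k else 0.
have dE (k : 'I_m) : d k = y 0 k - z 0 k by rewrite /d valK.
suff P0 : \poly_(i < m) d i = 0.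
  apply/rowP => k; apply/eqP; rewrite -subr_eq0 -dE.
  by have := congr1 (fun P : {poly F} => P`_k) P0; rewrite coef_poly ltn_ord coef0 => ->.
apply: (@poly3_root_eq0 m _ x) => //; rewrite ?size_poly //.
  move=> i; rewrite coef_poly; case: ltnP => [im|_]; last first.
    by rewrite /in_subfield expr0n.
  rewrite (dE (Ordinal im)) /in_subfield -(pFrobenius_autE char3) rmorphB /=.
  rewrite !pFrobenius_autE.
  by rewrite (eqP (Hy _)) (eqP (Hz _)).
apply/rootP; rewrite horner_poly -[RHS]E; apply: eq_bigr => k _.
by rewrite dE mulrBl.
Qed.

(** The [3 ^ m] ternary rows of length [m] evaluate injectively, hence bijectively, into [F]. So the
    last [k] entries of a kernel word are free and determine the first [m]. *)
Lemma card_row_eval_kernel m k n (x : F) :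
  n = (m + k)%N -> #|F| = (3 ^ m)%N ->
  {in gtn m &, injective (fun j => x ^+ (3 ^ j))} ->
  #|[set y in rows3 n | row_eval x y == 0]| = (3 ^ k)%N.
Proof.
move=> -> cF injx; have ev_inj := row_eval_inj injx.
have onto v : exists2 y, y \in rows3 m & row_eval x y = v.
  have: [set row_eval x y | y in rows3 m] = [set: F].
    apply/eqP; rewrite eqEcard subsetT /= cardsT cF card_in_imset //.
    by rewrite card_rows3.
  by move/setP/(_ v); rewrite in_setT => /imsetP[y]; exists y.
pose s v := if [pick y in rows3 m | row_eval x y == v] is Some y then y else 0.
have sP v : s v \in rows3 m /\ row_eval x (s v) = v.
  rewrite /s; case: pickP => [y /andP[? /eqP]|H] //.
  by have [y ry ev] := onto v; have := H y; rewrite /= ry ev eqxx.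
have ev_row (y : 'rV_m) (t : 'rV_k) :
    row_eval x (row_mx y t) = row_eval x y + x ^+ m * row_eval x t.
  rewrite /row_eval big_split_ord /= mulr_sumr; congr (_ + _); apply: eq_bigr => i _.
    by rewrite row_mxEl.
  by rewrite row_mxEr exprD mulrCA.
have rows3_row (y : 'rV_m) (t : 'rV_k) :
    (row_mx y t \in rows3 (m + k)) = (y \in rows3 m) && (t \in rows3 k).
  rewrite !inE; apply/forallP/andP => [H|[/forallP Hy /forallP Ht] i].
    split; apply/forallP => i.
      by have := H (lshift k i); rewrite row_mxEl.
    by have := H (rshift m i); rewrite row_mxEr.
  by rewrite -(splitK i); case: (split i) => j /=; rewrite ?row_mxEl ?row_mxEr.
pose r (t : 'rV_k) := row_mx (s (- (x ^+ m * row_eval x t))) t.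
have r_inj : injective r by move=> t t' /eq_row_mx[].
rewrite -(card_rows3 k) -(card_imset _ r_inj); apply: eq_card => y.
apply/idP/imsetP => [|[t rt ->]]; rewrite inE; last first.
  by rewrite rows3_row rt andbT; have [-> e] := sP (- (x ^+ m * row_eval x t));
    rewrite ev_row e addNr eqxx.
rewrite -[y]hsubmxK rows3_row ev_row addr_eq0 => /andP[/andP[rl rr] /eqP e].
exists (rsubmx y) => //; rewrite /r; congr row_mx; apply: ev_inj => //.
  by case: (sP (- (x ^+ m * row_eval x (rsubmx y)))).
by case: (sP (- (x ^+ m * row_eval x (rsubmx y)))) => _ ->.
Qed.

(** If [x] were nonzero, [a * x] would run over [F], and the trace polynomial would have more roots
    than its degree allows. *)
Lemma trace_to_nondegenerate m (x : F) : (0 < m)%N -> #|F| = (3 ^ m)%N ->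
  (forall a, trace_to 1 m (a * x) = 0) -> x = 0.
Proof.
case: m => // m _ cF H; apply/eqP; apply: contraT => x0.
(* Here [m] is one less than in the statement: the degree is [3 ^ m], while [F] has [3 ^ m.+1]
   elements. *)
pose P : {poly F} := \sum_(j < m.+1) 'X^(3 ^ j).
have P3 : P`_(3 ^ m) = 1.
  rewrite coef_sum (bigD1 ord_max) //= coefXn eqxx big1 ?addr0 // => i ni.
  rewrite coefXn eqn_exp2l //; case: eqP => // mi.
  by case/eqP: ni; apply: val_inj.
have P0 : P != 0.
  by apply/eqP=> E; move/eqP: P3; rewrite E coef0 eq_sym oner_eq0.
have sP : (size P <= (3 ^ m).+1)%N.
  apply: (leq_trans (size_sum _ _ _)); apply/bigmax_leqP => i _.
  by rewrite size_polyXn ltnS leq_exp2l // -ltnS.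
have: all (root P) (enum F).
  apply/allP => a _; apply/rootP; rewrite -[RHS](H (a / x)) divfK //.
  by rewrite horner_sum; apply: eq_bigr => i _; rewrite hornerXn mul1n.
move/(max_poly_roots P0); rewrite enum_uniq -cardE cF => /(_ isT) lt.
have := leq_trans lt sP; rewrite ltnS leq_exp2l // ltnn //.
Qed.

(** Ternary entries of [y] pass through Frobenius, so pairing [y] with the codeword of [a] gives the
    trace of [a * row_eval x y]; nondegeneracy of the trace does the rest. *)
Lemma dual_trace_codeE m n (x : F) : (0 < m)%N -> #|F| = (3 ^ m)%N ->
  dual_over 3 [set \row_(i < n) trace_to 1 m (a * x ^+ i) | a : F] =
  [set y in rows3 n | row_eval x y == 0].
Proof.
move=> m0 cF; apply/setP => y; rewrite !inE.
have [/forallP Hy|//] :=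
  boolP [forall i, in_subfield 3 (y 0 i)]; rewrite /=.
have E a : \sum_(i < n) y 0 i * (\row_(i < n) trace_to 1 m (a * x ^+ i)) 0 i
           = trace_to 1 m (a * row_eval x y).
  rewrite /trace_to; under eq_bigr do rewrite mxE /trace_to mulr_sumr.
  rewrite exchange_big; apply: eq_bigr => j _ /=.
  rewrite mul1n exprMn exp3_sum mulr_sumr; apply: eq_bigr => i _.
  by rewrite !exprMn (in_subfield_exp j (Hy i)) mulrCA.
apply/forall_inP/eqP => [H|e c /imsetP[a _ ->]].
  apply: (trace_to_nondegenerate m0 cF) => a; rewrite -E; apply/eqP/H.
  exact: imset_f.
rewrite E e mulr0 /trace_to big1 // => j _.
by rewrite expr0n expn_eq0.
Qed.

End CharThree.

(** * The field ['F_p]: its additive characters and its quadratic character *)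

Lemma is_mult_order_prim_root p a :
  prime p -> is_mult_order p a p.-1 -> p.-1.-primitive_root (a%:R : 'F_p).
Proof.
move=> p_pr [k0 [ak alt]].
have powE j : ((a%:R : 'F_p) ^+ j == 1) = (a ^ j == 1 %[mod p]).
  by rewrite -natrX -[1%R]/(1%:R) -(inj_eq (@ord_inj _)) !val_Fp_nat.
rewrite /primitive_root_of_unity k0 /=; apply/forallP => i.
rewrite unity_rootE powE; apply/eqP.
have [->|ne] := eqVneq i.+1 p.-1; first by rewrite ak eqxx.
by apply/eqP; apply: alt; apply/andP; split=> //; rewrite ltn_neqAle ne ltn_ord.
Qed.

Lemma odd_pred_double n : odd n -> n.-1 = (2 * (n.-1 %/ 2))%N.
Proof. lia. Qed.

Section PrimeField.
Variable p : nat.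
Hypothesis p_pr : prime p.

Lemma natr_Fp (x : 'F_p) : (x : nat)%:R = x :> 'F_p.
Proof. exact: natr_Zp. Qed.

Lemma natr_Fp_eq (m n : nat) : (m%:R == n%:R :> 'F_p) = (m == n %[mod p]).
Proof. by rewrite -(inj_eq (@ord_inj _)) !val_Fp_nat. Qed.

Lemma natr_ord_bij : bijective (fun i : 'I_p => i%:R : 'F_p).
Proof.
apply: inj_card_bij; last by rewrite card_Fp // card_ord.
move=> i j /eqP; rewrite natr_Fp_eq !modn_small // => /eqP; exact: val_inj.
Qed.

Lemma big_Fp (V : nmodType) (G : 'F_p -> V) :
  \sum_x G x = \sum_(i < p) G i%:R.
Proof. by rewrite (reindex _ (onW_bij _ natr_ord_bij)). Qed.

Lemma wt_supp (F : finFieldType) (c : 'rV[F]_p) (g : 'F_p -> F) :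
  (forall i : 'I_p, (c 0 i != 0) = (g i%:R != 0)) -> wt c = #|supp g|.
Proof.
move=> H; rewrite /wt -(card_imset _ (bij_inj natr_ord_bij)).
apply: eq_card => x; have [k _ kK] := natr_ord_bij.
apply/imsetP/idP => [[i + ->]|]; rewrite !inE ?H // => gx.
by exists (k x); rewrite ?inE ?H ?kK.
Qed.

(** When [z ^+ p = 1] this is the additive character of ['F_p] taking 1 to [z]. *)
Definition zpow (F : finFieldType) (z : F) (x : 'F_p) : F := z ^+ (x : nat).

Lemma zpow_nat (F : finFieldType) (z : F) n :
  z ^+ p = 1 -> zpow z n%:R = z ^+ n.
Proof. by move=> zp; rewrite /zpow val_Fp_nat // expr_mod. Qed.

Lemma zpowD (F : finFieldType) (z : F) x y :
  z ^+ p = 1 -> zpow z (x + y) = zpow z x * zpow z y.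
Proof.
by move=> zp; rewrite -[x]natr_Fp -[y]natr_Fp -natrD !zpow_nat // exprD.
Qed.

Lemma zpowMn (F : finFieldType) (z : F) n x :
  z ^+ p = 1 -> zpow z (n%:R * x) = zpow z x ^+ n.
Proof.
by move=> zp; rewrite -[x]natr_Fp -natrM !zpow_nat // exprM exprAC.
Qed.

Lemma zpow0 (F : finFieldType) (z : F) : zpow z 0 = 1.
Proof. by []. Qed.

(** The Legendre symbol with values in [F], encoded by Euler's criterion: [p./2] is [(p - 1) / 2]
    for odd [p]. *)
Definition qchar (F : finFieldType) (x : 'F_p) : F :=
  if x == 0 then 0 else if x ^+ p./2 == 1 then 1 else -1.

Hypothesis p_odd : odd p.

Lemma Fp_half_exp (x : 'F_p) : x != 0 -> (x ^+ p./2 == 1) || (x ^+ p./2 == -1).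
Proof.
move=> x0; rewrite -eqf_sqr expr1n -exprM muln2; apply/eqP.
apply: (mulfI x0); rewrite -exprS mulr1.
have -> : (p./2.*2.+1 = p)%N by have := odd_double_half p; rewrite p_odd.
by have := expf_card x; rewrite card_Fp.
Qed.

Lemma qchar0 F : qchar F 0 = 0.
Proof. by rewrite /qchar eqxx. Qed.

Lemma Fp_N1_neq1 : (-1 == 1 :> 'F_p) = false.
Proof.
rewrite eq_sym -subr_eq0 opprK -[1 + 1]/(2%:R) -[0]/(0%:R) natr_Fp_eq.
by rewrite mod0n modn_small // odd_prime_gt2.
Qed.

Lemma qcharM F x y : qchar F (x * y) = qchar F x * qchar F y.
Proof.
rewrite /qchar mulf_eq0; have [->|x0] := eqVneq x 0; first by rewrite /= mul0r.
have [->|y0] := eqVneq y 0; first by rewrite /= mulr0.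
rewrite /= exprMn.
by case/orP: (Fp_half_exp x0) => /eqP->; case/orP: (Fp_half_exp y0) => /eqP->;
  rewrite ?(mulr1, mul1r, mulrNN, Fp_N1_neq1, eqxx, mulN1r, mulrN1, opprK).
Qed.

Lemma qchar_sqr F x : x != 0 -> qchar F x * qchar F x = 1.
Proof.
by move=> x0; rewrite /qchar (negPf x0); case: ifP => _; rewrite ?mulrNN mulr1.
Qed.

(** * Gauss sums, trace words and Fourier inversion when 3 is a primitive root modulo [p] *)

Section Codes3.
Variable F : finFieldType.
Hypothesis char3 : 3 \in [pchar F].
Hypothesis ord3 : is_mult_order p 3 p.-1.
Hypothesis p_gt3 : (3 < p)%N.

Let r := (p.-1 %/ 2)%N.
Let prim3 := is_mult_order_prim_root p_pr ord3.

(** A primitive root is not a square, so 3 can serve as the dilating factor [u]. *)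
Lemma qchar3 : qchar F 3%:R = -1.
Proof.
rewrite /qchar -(prim_order_dvd prim3) -[0]/(0%:R) natr_Fp_eq mod0n modn_small //=.
case: ifP => // /dvdn_leq; clear -p_gt3 p_odd; lia.
Qed.

Lemma p_neq0 : p%:R != 0 :> F.
Proof.
rewrite -(dvdn_pcharf char3); apply/negP => d.
by move: p_gt3; rewrite -(prime_nt_dvdP p_pr _ d).
Qed.

(** The exponents [3 ^ j] with [j < p.-1] are distinct already modulo the divisor [p] of [n],
    because 3 has order [p.-1] there. *)
Lemma conjugates_inj n (x : F) : n.-primitive_root x -> (p %| n)%N ->
  {in gtn p.-1 &, injective (fun j => x ^+ (3 ^ j))}.
Proof.
move=> xn pn i j ip jp /eqP; rewrite (eq_prim_root_expr xn) => e.
have {e} : (3 ^ i == 3 ^ j %[mod p]).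
  by rewrite -(modn_dvdm _ pn) (eqP e) modn_dvdm.
rewrite -natr_Fp_eq !natrX (eq_prim_root_expr prim3) !modn_small // => /eqP //.
Qed.

Definition gauss (z : F) : F := \sum_x qchar F x * zpow z x.

Lemma qchar_subfield3 x : in_subfield 3 (qchar F x).
Proof.
by apply/in_subfield3P; rewrite /qchar !inE; case: ifP => _; first
  [by rewrite eqxx | case: ifP => _; rewrite eqxx ?orbT].
Qed.

Lemma gauss_neq0 (z : F) : p.-primitive_root z -> gauss z != 0.
Proof.
move=> zp; apply/eqP=> g0.
(* This is the Gauss sum divided by [z]: the term at 0 vanishes, and the shift by one brings the
   size down to the [p.-1] available conjugates. The constant coefficient is [qchar] at 1, hence
   nonzero. *)
pose P : {poly F} := \poly_(i < p.-1) qchar F (i.+1)%:R.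
have P0 : P = 0.
  apply: (@poly3_root_eq0 F char3 p.-1 P z).
  - move=> i; rewrite coef_poly; case: ifP => _; first exact: qchar_subfield3.
    by rewrite /in_subfield expr0n.
  - exact: size_poly.
  - exact: conjugates_inj zp (dvdnn p).
  apply/rootP; rewrite horner_poly.
  have z0 : z != 0.
    apply/eqP=> z0; have /eqP := prim_expr_order zp.
    by rewrite z0 expr0n -leqn0 leqNgt prime_gt0 // eq_sym oner_eq0.
  apply: (mulIf z0); rewrite mul0r -[RHS]g0 /gauss big_Fp.
  rewrite -(big_mkord xpredT (fun i => qchar F i%:R * zpow z i%:R)).
  rewrite big_ltn ?prime_gt0 // qchar0 mul0r add0r big_add1 big_mkord mulr_suml.
  apply: eq_bigr => i _; rewrite -mulrA -exprSr.
  by rewrite zpow_nat ?(prim_expr_order zp).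
have := congr1 (fun Q : {poly F} => Q`_0) P0; rewrite coef_poly coef0.
have -> : (0 < p.-1)%N by rewrite -ltnS prednK ?prime_gt0 ?prime_gt1.
rewrite /qchar -[0]/(0%:R) natr_Fp_eq mod0n modn_small ?prime_gt1 //= expr1n eqxx.
by move/eqP; rewrite oner_eq0.
Qed.

(** Additive characters are eigenvectors of convolution. The eigenvalue does not depend on [v],
    since [qchar] ignores nonzero square factors. *)
Lemma paley_zpow (z : F) v x : z ^+ p = 1 -> v != 0 ->
  paley (qchar F) (fun y => zpow z (v * v * y)) x =
  qchar F (-1) * gauss z * zpow z (v * v * x).
Proof.
move=> zp v0; rewrite /paley /gauss.
pose h t := x + (v * v)^-1 * t.
have vv0 : v * v != 0 by rewrite mulf_neq0.
have h_inj : injective h.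
  by move=> s t /addrI /mulfI; apply; rewrite invr_eq0.
rewrite (reindex_inj h_inj) /= mulr_sumr mulr_suml; apply: eq_bigr => t _.
have -> : x - h t = (-1) * ((v^-1 * v^-1) * t) by rewrite /h invfM; ring.
have -> : v * v * h t = v * v * x + t by rewrite /h mulrDr mulVKf.
rewrite !qcharM qchar_sqr ?invr_eq0 // zpowD //; ring.
Qed.

Definition trace_word (z a b : F) (x : 'F_p) : F :=
  a + trace_to 2 r (b * zpow z x).

(** The conjugates in the trace have frequencies [3 ^ (2 * j)], all squares, so they share the
    eigenvalue [lam]; the constant [a] is annihilated because [qchar] sums to 0. *)
Lemma paley_trace_word (z a b : F) x : z ^+ p = 1 ->
  let lam := qchar F (-1) * gauss z in
  paley (qchar F) (trace_word z a b) x = lam * trace_word z a b x - lam * a.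
Proof.
move=> zp lam.
have three0 : 3%:R != 0 :> 'F_p.
  by rewrite -[0]/(0%:R) natr_Fp_eq mod0n modn_small.
have termE j y : (b * zpow z y) ^+ (3 ^ (2 * j)) =
    b ^+ (3 ^ (2 * j)) * zpow z (3%:R ^+ j * 3%:R ^+ j * y).
  by rewrite exprMn -exprD addnn -mul2n -natrX zpowMn.
rewrite mulrDr addrC addKr.
rewrite /paley /trace_word.
under eq_bigr do rewrite mulrDr.
rewrite big_split /= -mulr_suml.
have inj : injective (fun y : 'F_p => x - y) by move=> s t /addrI /oppr_inj.
have := sum_chi (qchar0 F) (qcharM F) qchar3 (two_neq0_char3 char3).
rewrite (reindex_inj inj) /= => ->; rewrite mul0r add0r.
rewrite /trace_to; under eq_bigr do rewrite mulr_sumr.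
rewrite exchange_big mulr_sumr; apply: eq_bigr => j _ /=.
rewrite termE mulrCA -paley_zpow ?expf_neq0 // mulr_sumr; apply: eq_bigr => y _.
by rewrite termE mulrCA.
Qed.

Lemma trace_word_supp (z a b : F) : p.-primitive_root z ->
  (exists x, trace_word z a b x != 0) ->
  (p <= #|supp (trace_word z a b)| ^ 2)%N.
Proof.
move=> zp nz; rewrite -{1}(card_Fp p_pr).
have N10 : -1 != 0 :> 'F_p by rewrite oppr_eq0 oner_eq0.
apply: (paley_eigen_supp (qchar0 F) (qcharM F) (@qchar_sqr F) qchar3
  (two_neq0_char3 char3) _ _
  (fun x => paley_trace_word a b x (prim_expr_order zp))) => //.
  by rewrite card_Fp // p_neq0.
rewrite mulf_neq0 ?gauss_neq0 //.
exact: (chi_neq0 (@qchar_sqr F)).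
Qed.

(** Orthogonality of characters: for nonzero [w], a shift by 1 multiplies the sum by [z], which is
    not 1. *)
Lemma sum_zpow (z : F) w : p.-primitive_root z ->
  \sum_s zpow z (s * w) = if w == 0 then p%:R else 0.
Proof.
move=> zp; have zp1 := prim_expr_order zp; case: eqVneq => [->|w0].
  under eq_bigr do rewrite mulr0 zpow0.
  by rewrite sumr_const card_Fp.
have -> : \sum_s zpow z (s * w) = \sum_s zpow z s.
  by rewrite [RHS](reindex_inj (mulIf w0)).
set S := \sum_s _; have: S = z * S.
  rewrite {1}/S (reindex_inj (addrI 1)) /= mulr_sumr; apply: eq_bigr => s _.
  by rewrite zpowD // -[1]/(1%:R) zpow_nat.
move/eqP; rewrite -subr_eq0 -{1}[S]mul1r -mulrBl mulf_eq0 => /orP[|/eqP//].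
rewrite subr_eq0 eq_sym -[z]expr1 -(prim_order_dvd zp) dvdn1.
by move: p_gt3; case: eqP => // ->.
Qed.

(** Every nonzero residue is a power of 3; even exponents give the squares, odd ones the
    non-squares. *)
Lemma big_Fp_prim3 (G : 'F_p -> F) :
  \sum_s G s = G 0 + \sum_(j < r) G (3%:R ^+ (2 * j))
                   + \sum_(j < r) G (3%:R * 3%:R ^+ (2 * j)).
Proof.
have split_parity n (H : nat -> F) : \sum_(j < 2 * n) H j =
    \sum_(j < n) H (2 * j)%N + \sum_(j < n) H (2 * j).+1.
  elim: n => [|n IH]; first by rewrite !big_ord0 addr0.
  by rewrite mulnS !addSn add0n !big_ord_recr /= IH; ring.
rewrite (bigD1 0) //= -addrA; congr (_ + _).
under [X in _ = _ + X]eq_bigr do rewrite -exprS.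
rewrite -(split_parity r (fun j => G (3%:R ^+ j))) -(odd_pred_double p_odd).
pose e (j : 'I_p.-1) : 'F_p := 3%:R ^+ j.
have e_inj : injective e.
  move=> i j /eqP; rewrite /e (eq_prim_root_expr prim3) !modn_small // => /eqP.
  exact: val_inj.
rewrite -(big_imset _ (in2W e_inj)) /=; apply: eq_bigl => s; apply/idP/idP.
  move=> s0; have: s ^+ p.-1 = 1.
    apply: (mulfI s0); rewrite -exprS mulr1 prednK ?prime_gt0 //.
    by have := expf_card s; rewrite card_Fp.
  move/(prim_rootP prim3) => [i ->]; exact: imset_f.
case/imsetP=> i _ ->; rewrite expf_neq0 //.
by rewrite -[0]/(0%:R) natr_Fp_eq mod0n modn_small.
Qed.

(* Only the frequencies [0] and [3 * 9^j] survive in the inverse Fourier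
   transform, so a suitable dilation of [f] has the required shape. *)
Lemma trace_word_of_kernel (xi z : F) (f : 'F_p -> F) :
  p.-primitive_root xi -> p.-primitive_root z ->
  (forall x, in_subfield 9 (f x)) -> \sum_x f x * zpow xi x = 0 ->
  exists v a b, [/\ v != 0, in_subfield 9 a &
    forall x, f (v * x) = trace_word z a b x].
Proof.
move=> xip zp Hf f0; have xi1 := prim_expr_order xip.
have three0 : 3%:R != 0 :> 'F_p.
  by rewrite -[0]/(0%:R) natr_Fp_eq mod0n modn_small.
have [k zk] := prim_rootP xip (prim_expr_order zp).
have k0 : (k%:R : 'F_p) != 0.
  rewrite -[0]/(0%:R) natr_Fp_eq mod0n modn_small //; apply/eqP=> k0.
  have := prim_order_dvd zp 1; rewrite zk k0 expr0 expr1n eqxx dvdn1.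
  by move: p_gt3; case: eqP => // ->.
pose fh s := \sum_x f x * zpow xi (s * x).
(* Values in GF(9) are fixed by the ninth power map, so the Fourier coefficient at [9 ^ j * s] is a
   conjugate of the one at [s]; the zero at 1 spreads to all squares. *)
have fh9 s j : fh (3%:R ^+ (2 * j) * s) = fh s ^+ (3 ^ (2 * j)).
  rewrite /fh exp3_sum //; apply: eq_bigr => x _.
  rewrite -mulrA -natrX zpowMn // exprMn; congr (_ * _).
  by rewrite expnM (in_subfield_exp j (Hf x)).
have inv y : p%:R * f y = \sum_s fh s * zpow xi (- (s * y)).
  rewrite /fh; under [RHS]eq_bigr do rewrite mulr_suml.
  rewrite exchange_big /= (bigD1 y) //= [X in _ + X]big1 => [|x xy].
    rewrite addr0; under eq_bigr do rewrite -mulrA -zpowD // subrr zpow0 mulr1.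
    by rewrite sumr_const card_Fp // mulr_natl.
  under eq_bigr do rewrite -mulrA -zpowD // -mulrBr.
  by rewrite -mulr_sumr sum_zpow // subr_eq0 (negPf xy) mulr0.
have p3 : in_subfield 3 (p%:R^-1 : F).
  by rewrite /in_subfield exprVn -(pFrobenius_autE char3) rmorph_nat.
(* Since [z = xi ^+ k], the inverse transform at [v * x] turns frequency 3 into [zpow z x] when
   [- 3 * v = k]. *)
pose v : 'F_p := - (k%:R / 3%:R).
exists v, (p%:R^-1 * fh 0), (p%:R^-1 * fh 3%:R); split.
- by rewrite oppr_eq0 mulf_neq0 ?invr_eq0.
- apply: in_subfieldM; first exact: in_subfield9W.
  apply: (in_subfield_sum char3 (j := 2)) => x _.
  by apply: in_subfieldM => //; rewrite mul0r zpow0 /in_subfield expr1n.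
move=> x; apply: (mulfI p_neq0); rewrite inv big_Fp_prim3.
rewrite [X in _ + X + _]big1 ?addr0; last first.
  move=> j _; rewrite -[3%:R ^+ _]mulr1 fh9.
  have -> : fh 1 = 0 by rewrite -[RHS]f0; apply: eq_bigr => y _; rewrite mul1r.
  by rewrite expr0n expn_eq0 mul0r.
rewrite mul0r oppr0 zpow0 mulr1 /trace_word mulrDr mulVKf ?p_neq0 //.
congr (_ + _); rewrite /trace_to mulr_sumr; apply: eq_bigr => j _.
rewrite [3%:R * _]mulrC fh9 !exprMn (in_subfield_exp _ p3) !mulrA divff ?p_neq0 //.
rewrite mul1r; congr (_ * _).
have -> : zpow z x = zpow xi (k%:R * x) by rewrite zpowMn // /zpow zk exprAC.
rewrite -zpowMn // natrX; congr zpow.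
rewrite /v; field; exact: three0.
Qed.

End Codes3.
End PrimeField.

(** * Roots of unity, minimum distance and the folding of words of length [2 * p] *)

Lemma prime_prim_root (R : nzRingType) p (z : R) :
  prime p -> z ^+ p = 1 -> z != 1 -> p.-primitive_root z.
Proof.
move=> p_pr zp z1; have [k zk kp] := prim_order_exists (prime_gt0 p_pr) zp.
have [kE|<- //] := pred2P (proj2 (primeP p_pr) k kp).
by move: z1; rewrite -[z]expr1 -kE (prim_expr_order zk) eqxx.
Qed.

(** The premise [Q n.+1] covers the conventional value for a code without nonzero words. *)
Lemma mindist_ind (F : finFieldType) n (C : {set 'rV[F]_n}) (Q : nat -> Prop) :
  Q n.+1 -> (forall c, c \in C -> c != 0 -> Q (wt c)) -> Q (mindist C).
Proof.
move=> Q0 QC; apply: (big_ind Q) => // [a b Qa Qb|c /andP[]]; last exact: QC.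
by rewrite /minn; case: ifP.
Qed.

Lemma mindist_le_succ (F : finFieldType) n (C : {set 'rV[F]_n}) :
  (mindist C <= n.+1)%N.
Proof.
rewrite /mindist; apply: (big_rec (fun d => (d <= n.+1)%N)) => // c d _ dn.
by rewrite geq_min dn orbT.
Qed.

Lemma mindist_le_wt (F : finFieldType) n (C : {set 'rV[F]_n}) c :
  c \in C -> c != 0 -> (mindist C <= wt c)%N.
Proof.
move=> cC c0; rewrite /mindist -big_filter.
have: c \in [seq d <- index_enum _ | (d \in C) && (d != 0)].
  by rewrite mem_filter cC c0 mem_index_enum.
elim: [seq _ <- _ | _] => // d s IH; rewrite inE big_cons geq_min.
by case/orP => [/eqP->|/IH->]; rewrite ?leqnn ?orbT.
Qed.

Lemma wt_eq0 (F : finFieldType) n (c : 'rV[F]_n) : (wt c == 0%N) = (c == 0).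
Proof.
rewrite /wt cards_eq0; apply/eqP/eqP => [/setP H|->].
  by apply/rowP => i; have := H i; rewrite !inE mxE => /negbFE/eqP.
by apply/setP => i; rewrite !inE mxE eqxx.
Qed.

(** Modulo 4 the power is a power of 9, hence 1; modulo [p] the order of 3 applies. This makes the
    exponent defining [beta] an exact quotient. *)
Lemma dvd4p_pred_exp p :
  odd p -> is_mult_order p 3 p.-1 -> (4 * p %| (3 ^ p.-1).-1)%N.
Proof.
move=> p_odd ord3.
have gt0 : (0 < 3 ^ p.-1)%N by rewrite expn_gt0.
rewrite Gauss_dvd; last by rewrite (@coprimeXl 2 2) // coprime2n.
rewrite -subn1 -!eqn_mod_dvd //.
have [_ [-> _]] := ord3; rewrite eqxx andbT.
by rewrite (odd_pred_double p_odd) expnM -modnXm exp1n.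
Qed.

Lemma prim_root_half_N1 (R : idomainType) n (x : R) :
  (2 * n)%N.-primitive_root x -> x ^+ n = -1.
Proof.
move=> xp; have: (x ^+ n) ^+ 2 == 1 ^+ 2.
  by rewrite expr1n -exprM mulnC (prim_expr_order xp).
rewrite eqf_sqr -(prim_order_dvd xp) => /orP[/dvdn_leq|/eqP//].
by have := prim_order_gt0 xp; lia.
Qed.

Lemma N1_neq1 (F : finFieldType) : 3 \in [pchar F] -> -1 != 1 :> F.
Proof.
by move=> char3; rewrite eq_sym -subr_eq0 opprK -mulr2n (two_neq0_char3 char3).
Qed.

(** A square root [w] of -1 lies outside GF(3): there [w ^+ 3 = w], whereas [w * w = -1] gives
    [w ^+ 3 = - w]. *)
Lemma subfield3_indep (F : finFieldType) (w s t : F) :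
  3 \in [pchar F] -> w * w = -1 ->
  in_subfield 3 s -> in_subfield 3 t -> s + w * t = 0 -> s = 0 /\ t = 0.
Proof.
move=> char3 w2 s3 t3 e.
have [t0|t0] := eqVneq t 0; first by move: e; rewrite t0 mulr0 addr0.
have wE : w = - s * t^-1.
  by apply: (mulIf t0); rewrite divfK //; apply/eqP; rewrite -addr_eq0 addrC e.
have w3 : w ^+ 3 = w.
  rewrite {1}wE exprMn exprVn (eqP t3) exprNn (eqP s3) [in RHS]wE.
  by congr (_ * _); ring.
have /eqP : w * w * w = w by rewrite -[RHS]w3; ring.
have w0 : w != 0.
  by apply/eqP=> w0; move/eqP: w2; rewrite w0 mul0r eq_sym oppr_eq0 oner_eq0.
by rewrite w2 -subr_eq0 -{2}[w]mul1r -mulrBl mulf_eq0 (negPf w0) orbF subr_eq0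
  (negPf (N1_neq1 char3)).
Qed.

(** The sign [(-1) ^+ i] is fixed by the ninth power map, so it factors out of the trace and leaves
    the [p]-th root of unity [- x]; supports are unaffected. *)
Lemma row_trace_word p (F : finFieldType) (x a b : F) i :
  prime p -> (- x) ^+ p = 1 ->
  a * (-1) ^+ i + trace_to 2 (p.-1 %/ 2) (b * x ^+ i) =
  (-1) ^+ i * trace_word (- x) a b (i%:R : 'F_p).
Proof.
move=> p_pr xp; rewrite /trace_word mulrDr mulrC; congr (_ + _).
rewrite /trace_to mulr_sumr; apply: eq_bigr => j _.
rewrite zpow_nat // (exprNn x) mulrCA [in RHS]exprMn mulrA.
suff -> : ((-1) ^+ i) ^+ (3 ^ (2 * j)) = (-1) ^+ i :> F.
  by rewrite -expr2 sqrr_sign mul1r.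
apply: in_subfield_exp; rewrite /in_subfield -exprM mulnC exprM.
by rewrite !exprS expr0 mulr1 !mulN1r opprK.
Qed.

(** Write [theta = eta * xi] with [eta ^+ 4 = 1] and [xi] of order [p]. Positions [i] and [p + i]
    merge into one GF(9) symbol, since [theta ^+ p] is a square root of -1, and the twist by
    [eta ^+ i] moves the zero from [theta] to [xi]. *)
Lemma fold_kernel_row p (F : finFieldType) (theta z : F) (y : 'rV[F]_(2 * p)) :
  prime p -> odd p -> (3 < p)%N -> is_mult_order p 3 p.-1 ->
  3 \in [pchar F] ->
  (4 * p)%N.-primitive_root theta -> p.-primitive_root z ->
  y \in rows3 F (2 * p) -> row_eval theta y = 0 -> y != 0 ->
  exists a b, [/\ in_subfield 9 a, exists x, trace_word z a b (x : 'F_p) != 0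
    & (#|supp (trace_word z a b : 'F_p -> F)| <= wt y)%N].
Proof.
move=> p_pr p_odd p_gt3 ord3 char3 thp zp; rewrite inE => /forallP y3 ev0 y0.
pose w := theta ^+ p; pose eta := theta ^+ (p * p); pose xi := theta / eta.
have th1 := prim_expr_order thp.
have w2 : w * w = -1.
  by rewrite -exprD addnn -mul2n; apply: prim_root_half_N1; rewrite mulnA.
have th0 : theta != 0.
  apply/eqP=> t0; move/eqP: th1.
  by rewrite t0 expr0n (gtn_eqF (prim_order_gt0 thp)) eq_sym oner_eq0.
have eta0 : eta != 0 by rewrite expf_neq0.
have eta4 : eta ^+ 4 = 1 by rewrite -exprM mulnC mulnA exprM th1 expr1n.
(* [p ^ 2] is 1 modulo 4, so [p ^ 3] and [p] agree modulo the order [4 * p] of [theta]; this gives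
   [xi ^+ p = 1]. *)
have etap : eta ^+ p = w.
  rewrite -exprM /w; apply/eqP; rewrite (eq_prim_root_expr thp) eqn_mod_dvd.
    have -> : (p * p * p - p = (p * p - 1) * p)%N by rewrite mulnBl mul1n.
    rewrite dvdn_pmul2r ?prime_gt0 // -[p]odd_double_half p_odd.
    by apply/dvdnP; exists (p./2 * p./2 + p./2)%N; lia.
  by rewrite -mulnA leq_pmulr // muln_gt0 prime_gt0.
have xip : p.-primitive_root xi.
  apply: prime_prim_root => //.
    by rewrite exprMn exprVn etap divff // expf_neq0.
  apply/eqP=> xi1; have te : theta = eta.
    by rewrite -[LHS](divfK eta0) -/xi xi1 mul1r.
  have /eqP := eta4; rewrite -te -(prim_order_dvd thp) => /dvdn_leq.
  by move: p_gt3; lia.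
have [Y YE] : exists Y : nat -> F, forall k : 'I_(2 * p), Y k = y 0 k.
  by exists (fun n => if insub n is Some k then y 0 k else 0) => k; rewrite valK.
have Y3 n : (n < 2 * p)%N -> in_subfield 3 (Y n).
  by move=> nlt; rewrite (YE (Ordinal nlt)).
have xlt (x : 'F_p) : (x < p)%N.
  by have := ltn_ord x; rewrite [X in (_ < X)%N](Fp_cast p_pr).
have lt1 (x : 'F_p) : (x < 2 * p)%N by rewrite mul2n -addnn ltn_addr.
have lt2 (x : 'F_p) : (p + x < 2 * p)%N by rewrite mul2n -addnn ltn_add2l.
pose f (x : 'F_p) := (Y x + w * Y (p + x)%N) * eta ^+ x.
have w9 : in_subfield 9 w.
  rewrite /in_subfield.
  have -> : w ^+ 9 = (w * w) * (w * w) * ((w * w) * (w * w)) * w by ring.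
  by rewrite w2 mulrNN !mulr1 mul1r.
have eta9 : in_subfield 9 eta.
  by rewrite /in_subfield (exprD eta 8 1) (exprM eta 4 2) eta4 expr1n mul1r.
have f9 x : in_subfield 9 (f x).
  apply: in_subfieldM; last by rewrite /in_subfield -exprM mulnC exprM (eqP eta9).
  apply: (@in_subfieldD F char3 2).
    by apply: in_subfield9W; apply: Y3.
  apply: in_subfieldM => //.
  by apply: in_subfield9W; apply: Y3.
have f0 : \sum_x f x * zpow xi x = 0.
  rewrite -[RHS]ev0 /row_eval.
  under [RHS]eq_bigr do rewrite -YE.
  have -> : \sum_(i < 2 * p) Y i * theta ^+ i =
            \sum_(i < p) Y i * theta ^+ i + \sum_(i < p) Y (p + i)%N * theta ^+ (p + i).
    by rewrite mul2n -addnn big_split_ord.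
  rewrite -big_split big_Fp //=; apply: eq_bigr => i _.
  rewrite /f /zpow val_Fp_nat // modn_small // exprD -/w.
  rewrite -mulrA -exprMn (_ : eta * xi = theta); last first.
    by rewrite /xi mulrCA divff ?mulr1.
  by rewrite mulrDl -mulrA [w * _]mulrCA.
have [v [a [b [v0 a9 fE]]]] :=
  trace_word_of_kernel p_pr p_odd char3 ord3 p_gt3 xip zp f9 f0.
have supp_f : #|supp (trace_word z a b : 'F_p -> F)| = #|supp f|.
  rewrite -(card_imset _ (mulfI v0)); apply: eq_card => x.
  apply/imsetP/idP => [[t + ->]|]; first by rewrite !inE fE.
  rewrite inE => fx; exists (v^-1 * x); last by rewrite mulVKf.
  by rewrite inE -fE mulVKf.
exists a, b; split => //; last first.
  rewrite supp_f /wt.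
  (* A nonzero folded symbol at [x] needs a nonzero entry of [y] at [x] or [p + x], and both
     positions reduce to [x] modulo [p]. *)
  apply: leq_trans (leq_imset_card (fun k : 'I_(2 * p) => k%:R : 'F_p) _).
  apply: subset_leq_card; apply/subsetP => x; rewrite inE /f => fx.
  have [Yx|Yx] := eqVneq (Y x) 0.
    apply/imsetP; exists (Ordinal (lt2 x)).
      rewrite inE -YE /=; apply: contraNneq fx => ->.
      by rewrite Yx mulr0 addr0 mul0r.
    by rewrite /= natrD natr_Fp; have := pchar_Fp p_pr; move/pcharf0 => ->; rewrite add0r.
  by apply/imsetP; exists (Ordinal (lt1 x)); rewrite ?inE -?YE //= natr_Fp.
(* A nonzero entry survives folding because 1 and [w] are independent over GF(3). *)
have [k yk] : exists k, y 0 k != 0.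
  apply/existsP; apply: contraR y0 => /existsPn H.
  by apply/eqP/rowP => k; rewrite mxE; apply/eqP; rewrite -[_ == _]negbK H.
pose x : 'F_p := (k : nat)%:R.
have fx : f x != 0.
  rewrite mulf_neq0 ?expf_neq0 //; apply/eqP.
  move/(subfield3_indep char3 w2) => []; try exact: Y3.
  have xv : (x : nat) = (k %% p)%N by rewrite /x val_Fp_nat.
  move=> Y1 Y2; case/negP: yk; rewrite -YE.
  have klt := ltn_ord k; have [kp|kp] := ltnP k p.
    by move: Y1; rewrite xv modn_small // => ->.
  move: Y2; rewrite xv; have -> : (p + k %% p = k)%N; last by move=> ->.
  have kd : (k - p < p)%N by rewrite ltn_subLR // addnn -mul2n.
  by rewrite -{1}(subnK kp) modnDr modn_small // subnKC.
by exists (v^-1 * x); rewrite -fE mulVKf.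
Qed.

(** * Size of the dual code and the two distance bounds *)

Theorem theorem12 (rho : nat) (F : finFieldType) (alpha : F) (h : nat) :
  prime rho -> odd rho ->
  (rho %% 12 = 5 \/ rho %% 12 = 7)%N ->
  is_mult_order rho 3 rho.-1 ->
  3 \in [pchar F] ->
  #|F| = (3 ^ rho.-1)%N ->
  (#|F|.-1).-primitive_root alpha ->
  odd h -> (h < 4 * rho)%N ->
  (forall j : nat, h <> (3 ^ j %% (4 * rho))%N) ->
  h <> rho -> h <> (3 * rho)%N ->
  let m := rho.-1 in
  let beta := alpha ^+ ((3 ^ m).-1 %/ (4 * rho)) in
  let theta := beta^-1 in
  (* C(rho): the ternary code of length 2 rho *)
  let C : {set 'rV[F]_(2 * rho)} :=
    [set \row_(i < 2 * rho) trace_to 1 m (a * theta ^+ i) | a : F] in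
  (* the GF(9)-code \bar C(rho)^perp of length rho *)
  let Cbar_perp : {set 'rV[F]_rho} :=
    [set \row_(i < rho) (ab.1 * (-1) ^+ i
                         + trace_to 2 (m %/ 2) (ab.2 * beta ^+ (2 * h * i)))
       | ab in [set ab : F * F | in_subfield 9 ab.1]] in
  let Cperp := dual_over 3 C in
  #|Cperp| = (3 ^ rho.+1)%N /\
  (mindist Cbar_perp <= mindist Cperp)%N /\
  (rho <= (mindist Cbar_perp) ^ 2)%N.
Proof.
move=> p_pr p_odd p12 ord3 char3 cF alp h_odd h_lt _ h1 h3 m beta theta C Cbar Cperp.
have p_gt3 : (3 < rho)%N.
  by apply: leq_trans (leq_mod rho 12); case: p12 => ->.
have m0 : (0 < m)%N by rewrite /m; lia.
have bp : (4 * rho)%N.-primitive_root beta.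
  rewrite cF in alp.
  by have := dvdn_prim_root alp (dvd4p_pred_exp p_odd ord3).
have thp : (4 * rho)%N.-primitive_root theta.
  have gt0 : (0 < 4 * rho)%N by lia.
  have -> : theta = beta ^+ (4 * rho).-1.
    have b0 : beta != 0.
      apply/eqP=> b0; have /eqP := prim_expr_order bp.
      by rewrite b0 expr0n (gtn_eqF gt0) eq_sym oner_eq0.
    by apply: (mulfI b0); rewrite divff // -exprS prednK // prim_expr_order.
  rewrite prim_root_exp_coprime //.
  by rewrite coprime_sym -{1}(prednK gt0) coprimeSn.
have CE : Cperp = [set y in rows3 F (2 * rho) | row_eval theta y == 0].
  exact: dual_trace_codeE.
have bN1 : beta ^+ (2 * rho) = -1 by apply: prim_root_half_N1; rewrite mulnA.
pose x := beta ^+ (2 * h).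
have x_p : (- x) ^+ rho = 1.
  rewrite exprNn -signr_odd p_odd expr1 -exprM mulnAC exprM.
  rewrite bN1 -signr_odd h_odd expr1; ring.
have zp : rho.-primitive_root (- x).
  (* [- x = 1] would mean [beta ^+ (2 * h) = beta ^+ (2 * rho)], that is, [h] congruent to [rho]
     modulo [2 * rho]; below [4 * rho] only the excluded values [rho] and [3 * rho] qualify. *)
  apply: prime_prim_root => //; rewrite eqr_oppLR -bN1.
  rewrite (eq_prim_root_expr bp).
  have -> : (4 * rho = 2 * (2 * rho))%N by lia.
  rewrite -!muln_modr eqn_pmul2l // [(rho %% _)%N]modn_small; last first.
    by rewrite ltn_Pmull ?prime_gt0.
  have [lt|ge] := ltnP h (2 * rho); first by rewrite modn_small //; apply/eqP.
  rewrite -(subnK ge) modnDr modn_small; last by clear -h_lt ge; lia.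
  by apply/eqP; clear -h3 ge; lia.
have wordE a b i :
    a * (-1) ^+ i + trace_to 2 (m %/ 2) (b * beta ^+ (2 * h * i)) =
    (-1) ^+ i * trace_word (- x) a b (i%:R : 'F_rho).
  by rewrite exprM row_trace_word.
have wtE a b (c := \row_(i < rho) (a * (-1) ^+ i +
      trace_to 2 (m %/ 2) (b * beta ^+ (2 * h * i))) : 'rV[F]_rho) :
    wt c = #|supp (trace_word (- x) a b : 'F_rho -> F)|.
  by apply: wt_supp => // i; rewrite mxE wordE mulf_eq0 signr_eq0.
split; first by rewrite CE; apply: (card_row_eval_kernel char3 (m := m)) => //;
  [rewrite /m; lia | exact: (conjugates_inj p_pr ord3 thp (dvdn_mull _ _))].
split.
  apply: (mindist_ind (Q := fun d => (mindist Cbar <= d)%N)) => [|y].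
    (* Conventional value for [Cperp]: [mindist Cbar] is at most [rho + 1], hence at most
       [2 * rho + 1]. *)
    by apply: leq_trans (mindist_le_succ Cbar) _; lia.
  rewrite CE inE => /andP[y3 /eqP ev0] y0.
  have [a [b [a9 [t tn] le]]] :=
    fold_kernel_row p_pr p_odd p_gt3 ord3 char3 thp zp y3 ev0 y0.
  apply: leq_trans le; rewrite -wtE; apply: mindist_le_wt.
    by apply/imsetP; exists (a, b); rewrite ?inE.
  by rewrite -wt_eq0 wtE cards_eq0; apply/set0Pn; exists t; rewrite inE.
apply: (mindist_ind (Q := fun d => (rho <= d ^ 2)%N)) => [|c].
  by rewrite expnS expn1; apply: leq_trans (leqnSn _) _; rewrite leq_pmulr.
case/imsetP=> -[a b] _ ->; rewrite -wt_eq0 wtE => nz.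
apply: (trace_word_supp p_pr p_odd char3 ord3 p_gt3 zp).
by move: nz; rewrite cards_eq0 => /set0Pn[t]; rewrite inE; exists t.
Qed.
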